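(* Let $\alpha,\beta>-1$, let $w_{JS}(x)=x^{\alpha}(1-x)^{\beta}w_0(x)$, $x\in[0,1]$, be a shifted Jacobi-type weight function as in the context, and let $v_{JS}(x):=-\ln w_{JS}(x)$. The monic orthogonal polynomials $P_n(x)=P_n(x;\vec t\,)$ associated with $$w(x;\vec t\,):=w_{JS}(x)\left(\omega_0+\sum_{k=1}^{m}\omega_k\theta(x-t_k)\right),$$ where $w_{JS}$ is independent of $\vec t=(t_1,\dots,t_m)$ with $0\le t_1<\cdots<t_m\le1$, $\sum_{k=0}^{\ell}\omega_k\ge0$ for $0\le\ell\le m$, and $\theta(x)$ is the Heaviside step function, which is $1$ for $x>0$ and $0$ otherwise, with $h_n$, $\mathbf p(n)$, $\beta_n$ as in the context, satisfy the ladder operators $$P_n'(z)=-B_n(z)P_n(z)+\beta_nA_n(z)P_{n-1}(z),$$ $$P_{n-1}'(z)=\bigl(B_n(z)+v_{JS}'(z)\bigr)P_{n-1}(z)-A_{n-1}(z)P_n(z)$$ for $n\ge0$, with $A_{-1}(z)=B_0(z):=0$ and $$A_n(z)=\frac{1}{z-z^2}\left[\frac1{h_n}\int_0^1\frac{(z-z^2)v_{JS}'(z)-(x-x^2)v_{JS}'(x)}{z-x}P_n^2(x;\vec t\,)w(x;\vec t\,)\,dx+2n+1+\sum_{k=1}^{m}\frac{(t_k-t_k^2)\widehat R_{n,k}(\vec t\,)}{z-t_k}\right],\quad n\ge0,$$ $$\begin{aligned}B_n(z)=\frac{1}{z-z^2}\Biggl[&\frac1{h_{n-1}}\int_0^1\frac{(z-z^2)v_{JS}'(z)-(x-x^2)v_{JS}'(x)}{z-x}P_n(x;\vec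 t\,)P_{n-1}(x;\vec t\,)w(x;\vec t\,)\,dx\\&+n(z-1)-\mathbf p(n)+\sum_{k=1}^{m}\frac{(t_k-t_k^2)\widehat r_{n,k}(\vec t\,)}{z-t_k}\Biggr],\quad n\ge1,\end{aligned}$$ where $$\widehat R_{n,k}(\vec t\,):=\frac{\omega_kw_{JS}(t_k)P_n^2(t_k;\vec t\,)}{h_n},\qquad \widehat r_{n,k}(\vec t\,):=\frac{\omega_kw_{JS}(t_k)P_n(t_k;\vec t\,)P_{n-1}(t_k;\vec t\,)}{h_{n-1}}.$$
   Context: Weight: $w_0(x)$ is a continuously differentiable function, $w_0(x)>0$, and $w_0(x)$ is bounded at the endpoints $0,1$ of $[0,1]$; all moments $\int_0^1x^jw_{JS}(x)\,dx$, $j=0,1,\dots$, are finite. Polynomials: $P_0(x):=1$, $P_{-1}(x):=0$, and $P_j(x)=x^j+\mathbf p(j)x^{j-1}+\cdots$, $j\ge1$, is the monic polynomial of degree $j$ such that $\int_0^1P_i(x)P_j(x)w(x;\vec t\,)\,dx=h_j\delta_{ij}$ for $i,j\ge0$ ($\delta_{ij}$ is the Kronecker delta); thus $\mathbf p(j)$ is the coefficient of $x^{j-1}$ in $P_j$, and $\mathbf p(0):=0$. $\beta_j=h_j/h_{j-1}$ for $j\ge1$ (distinct from the exponent $\beta$); the term containing $\beta_0$ is multiplied by $P_{-1}=0$. A prime denotes differentiation.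
   Formalization: The identities are stated at points z in (0,1) different from all t_k at which the integral in A_0(z) converges absolutely; for w_0 merely continuously differentiable this integral can diverge at some z, and then A_n(z) is undefined. *)

(* Defs.v *)
From HB Require Import structures.
From mathcomp Require Import all_boot all_order all_algebra.
From mathcomp Require Import all_classical all_reals all_analysis.

Set Implicit Arguments.
Unset Strict Implicit.
Unset Printing Implicit Defensive.

Import Order.TTheory GRing.Theory Num.Theory.
Import numFieldNormedType.Exports.

Local Open Scope classical_set_scope.
Local Open Scope ring_scope.

(* Families t_1, ..., t_m and omega_0, ..., omega_m are functions on nat of
   which only the entries 1..m, resp. 0..m, are ever used. *)

(* At the endpoints 0 and 1 the total functions powR, ln and derive1 return
   finite values instead of possible infinities. These values are harmless: two
   points do not affect an integral, and in the sums over k the value of wJS at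
   an endpoint is multiplied by t_k - t_k^2 = 0. *)
Definition jacobi_weight (R : realType) (a b : R) (w0 : R -> R) (x : R) : R :=
  x `^ a * (1 - x) `^ b * w0 x.

Definition potential (R : realType) (w : R -> R) (x : R) : R := - ln (w x).

Definition heaviside (R : realType) (x : R) : R := (0 < x)%R%:R.

Definition jump_weight (R : realType) (wJS : R -> R) (m : nat)
    (omega t : nat -> R) (x : R) : R :=
  wJS x * (omega 0%N + \sum_(1 <= k < m.+1) omega k * heaviside (x - t k)).

(* u_(n-1), with the convention u_(-1) = 0 *)
Definition preceding (V : nmodType) (u : nat -> V) (n : nat) : V :=
  if n is n'.+1 then u n' else 0.

Definition monic_orthogonal (R : realType) (w : R -> R)
    (P : nat -> {poly R}) (h : nat -> R) : Prop :=
  [/\ forall j, size (P j) = j.+1,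
      forall j, P j \is monic,
      forall i j, \int[lebesgue_measure]_(x in `[0, 1])
        ((P i).[x] * (P j).[x] * w x) = h j * (i == j)%:R
    & forall j, 0 < h j].

(* bold p(n), the coefficient of x^(n-1) in P_n, with p(0) = 0 *)
Definition subleading (R : realType) (P : nat -> {poly R}) (n : nat) : R :=
  if n is n'.+1 then (P n)`_n' else 0.

(* beta_n = h_n / h_(n-1); the value at n = 0 only ever multiplies P_(-1) = 0 *)
Definition rec_beta (R : realType) (h : nat -> R) (n : nat) : R :=
  h n / h n.-1.

Definition ladder_kernel (R : realType) (v : R -> R) (z x : R) : R :=
  ((z - z ^+ 2) * derive1 v z - (x - x ^+ 2) * derive1 v x) / (z - x).

Definition Rhat (R : realType) (wJS : R -> R) (omega t : nat -> R)
    (P : nat -> {poly R}) (h : nat -> R) (n k : nat) : R :=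
  omega k * wJS (t k) * (P n).[t k] ^+ 2 / h n.

(* meaningful for n >= 1 only *)
Definition rhat (R : realType) (wJS : R -> R) (omega t : nat -> R)
    (P : nat -> {poly R}) (h : nat -> R) (n k : nat) : R :=
  omega k * wJS (t k) * (P n).[t k] * (P n.-1).[t k] / h n.-1.

Definition ladderA (R : realType) (wJS : R -> R) (m : nat)
    (omega t : nat -> R) (P : nat -> {poly R}) (h : nat -> R)
    (n : nat) (z : R) : R :=
  (z - z ^+ 2)^-1 *
    ((h n)^-1 * \int[lebesgue_measure]_(x in `[0, 1])
        (ladder_kernel (potential wJS) z x * (P n).[x] ^+ 2
         * jump_weight wJS m omega t x)
     + (2 * n + 1)%:R
     + \sum_(1 <= k < m.+1)
         (t k - t k ^+ 2) * Rhat wJS omega t P h n k / (z - t k)).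

Definition ladderB (R : realType) (wJS : R -> R) (m : nat)
    (omega t : nat -> R) (P : nat -> {poly R}) (h : nat -> R)
    (n : nat) (z : R) : R :=
  if n is n'.+1 then
    (z - z ^+ 2)^-1 *
      ((h n')^-1 * \int[lebesgue_measure]_(x in `[0, 1])
          (ladder_kernel (potential wJS) z x * (P n).[x] * (P n').[x]
           * jump_weight wJS m omega t x)
       + n%:R * (z - 1) - subleading P n
       + \sum_(1 <= k < m.+1)
           (t k - t k ^+ 2) * rhat wJS omega t P h n k / (z - t k))
  else 0.

(* All the integrals in A_n(z) and B_n(z) converge: this is the convergence of
   the one in A_0(z) (P_0 = 1), and polynomials are bounded on [0,1]. When the
   derivative of w0 is merely continuous this may fail at some z, because of
   the singularity of the kernel at x = z. *)
Definition ladder_convergent (R : realType) (wJS : R -> R) (m : nat)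
    (omega t : nat -> R) (z : R) : Prop :=
  lebesgue_measure.-integrable `[0, 1] (EFin \o (fun x : R =>
    ladder_kernel (potential wJS) z x * jump_weight wJS m omega t x)).

(* Main.v *)
Require Import Defs.
From HB Require Import structures.
From mathcomp Require Import all_boot all_order all_algebra.
From mathcomp Require Import all_classical all_reals all_analysis.
From mathcomp Require Import measurable_realfun ring lra zify.

Import Order.TTheory GRing.Theory Num.Theory.
Import numFieldNormedType.Exports.

Local Open Scope classical_set_scope.
Local Open Scope ring_scope.

(** Put [phi x = x - x^2], let [w] be the full weight and
      [D(x) = (P_(n-1)(z) P_n(x) - P_n(z) P_(n-1)(x)) / (z - x)],
    which is [- h_(n-1)] times the Christoffel-Darboux kernel, so that
    [int D S w = - h_(n-1) S(z)] for polynomials [S] of degree below [n].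
    For [p = P_n] (lowering) or [p = P_(n-1)] (raising), the combination
    [P_(n-1)(z) int K p P_n w - P_n(z) int K p P_(n-1) w] of the integrals in
    [A] and [B] equals [int K (z - x) p D w], where [K (z - x)] is
    [phi v'(z) - phi v'(x)]. As [v' = - wJS' / wJS], the part with [v'(x)] is
    integrated by parts on each interval between consecutive jumps: [phi wJS]
    vanishes at 0 and 1 because the exponents exceed -1, and the boundary terms
    at the [t_k] are exactly the sums of [Rhat] and [rhat]. What remains is
    [int (p D phi)' w], computed from the reproducing property, the leading
    coefficients and the three-term recurrence. *)

Set Implicit Arguments.
Unset Strict Implicit.

(** The factor [phi] as a formal polynomial, so that derivatives of products with it remain
    polynomials whose coefficients can be compared. *)
Definition endpoint_poly {R : realType} : {poly R} := 'X - 'X^2.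

Lemma monic_size1_eq1 (R : idomainType) (p : {poly R}) :
  size p = 1%N -> p \is monic -> p = 1.
Proof.
move=> sp /monicP; rewrite lead_coefE sp => p0.
by rewrite [p]size1_polyC ?sp//= p0.
Qed.

Lemma size_deriv_le (R : nzRingType) k (q : {poly R}) :
  (size q <= k.+1)%N -> (size (q^`())%R <= k)%N.
Proof.
move=> sq; apply/leq_sizeP => j kj.
by rewrite coef_deriv nth_default ?mul0rn// (leq_trans sq).
Qed.

(** * Orthogonal polynomials of an abstract linear functional *)

Section orthogonal_algebra.
Context (R : realType) (L : {linear {poly R} -> R^o})
        (P : nat -> {poly R}) (h : nat -> R).
Hypothesis size_P : forall j, size (P j) = j.+1.
Hypothesis P_monic : forall j, P j \is monic.
Hypothesis orth_P : forall i j, L (P i * P j) = h j * (i == j)%:R.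
Hypothesis h_neq0 : forall j, h j != 0.

Lemma functionalZ c p : L (c *: p) = c * L p.
Proof. exact: linearZ. Qed.

Lemma coef_monic n : (P n)`_n = 1.
Proof. by have /monicP := P_monic n; rewrite lead_coefE size_P. Qed.

Lemma coef_above n k : (n < k)%N -> (P n)`_k = 0.
Proof. by move=> nk; rewrite nth_default ?size_P. Qed.

Lemma size_sub_lead n (q : {poly R}) : (size q <= n.+1)%N ->
  (size (q - q`_n *: P n)%R <= n)%N.
Proof.
move=> sq; apply/leq_sizeP => j; rewrite leq_eqVlt => /predU1P[<-|nj].
  by rewrite coefB coefZ coef_monic mulr1 subrr.
have sj := leq_trans sq nj.
rewrite coefB coefZ (nth_default 0 sj) (nth_default _ (s := P n)) ?size_P//.
by rewrite mulr0 subrr.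
Qed.

(** Strong induction on the size of [q]: subtracting its leading coefficient times [P s], with [s]
    the degree of [q], lowers the size, and [L] kills [P s * P n] because [s < n]. *)
Lemma functional_lower_eq0 n (q : {poly R}) : (size q <= n)%N -> L (q * P n) = 0.
Proof.
have [k] := ubnP (size q); elim: k q => [q|k IH q sqk sqn]; first by rewrite ltn0.
case sq : (size q) => [|s].
  by move/eqP: sq; rewrite size_poly_eq0 => /eqP ->; rewrite mul0r linear0.
have sr := @size_sub_lead s q; rewrite {}sq in sqk sqn sr.
have {}sr := sr (leqnn _).
rewrite -[q](subrK (q`_s *: P s)) mulrDl linearD/= IH ?add0r.
- rewrite -scalerAl functionalZ orth_P.
  by rewrite (_ : s == n = false) ?mulr0 //; lia.
- by apply: leq_ltn_trans sr _; lia.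
- by apply: leq_trans sr _; lia.
Qed.

Lemma functional_top n (q : {poly R}) : (size q <= n.+1)%N -> L (q * P n) = q`_n * h n.
Proof.
move=> sq; rewrite -[in LHS](subrK (q`_n *: P n) q) mulrDl linearD/=.
rewrite functional_lower_eq0 ?add0r ?size_sub_lead//.
by rewrite -scalerAl functionalZ orth_P eqxx mulr1.
Qed.

(** If [q] had degree [s], testing it against [P s] would give [lead_coef q * h s], which is
    nonzero. *)
Lemma orthogonal_eq0 n (q : {poly R}) : (size q <= n)%N ->
  (forall j, (j < n)%N -> L (q * P j) = 0) -> q = 0.
Proof.
move=> sqn q0; apply/eqP; rewrite -size_poly_eq0; apply/eqP.
case sq : (size q) => [//|s]; have := q0 s; rewrite functional_top ?sq//.
have -> : q`_s = lead_coef q by rewrite lead_coefE sq.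
have /negbTE lq : lead_coef q != 0.
  by rewrite lead_coef_eq0 -size_poly_eq0 sq.
move=> /(_ (leq_trans _ sqn)); rewrite sq => /(_ (leqnn _)) /eqP.
by rewrite mulf_eq0 lq (negbTE (h_neq0 _)).
Qed.

(** The coefficients in degrees [n.+2] and [n.+1] match, so the difference of the two sides has
    degree at most [n]; it vanishes because [L] kills its products with all [P j], [j <= n]. *)
Lemma three_term n : 'X * P n.+1 = P n.+2
  + (subleading P n.+1 - subleading P n.+2) *: P n.+1 + (h n.+1 / h n) *: P n.
Proof.
apply: subr0_eq; set c := _ - _; set q := (X in X = 0).
have sq : (size q <= n.+1)%N.
  apply/leq_sizeP => j; rewrite leq_eqVlt => /predU1P[<-|nj].
    rewrite /q !coefB !coefD !coefZ coefXM (@coef_above n)//.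
    by rewrite coef_monic /c /=; ring.
  move: nj; rewrite leq_eqVlt => /predU1P[<-|nj].
    rewrite /q !coefB !coefD !coefZ coefXM /= !coef_monic.
    by rewrite (@coef_above n.+1 n.+2)// (@coef_above n n.+2)//; ring.
  rewrite /q !coefB !coefD !coefZ coefXM.
  rewrite (@coef_above n.+1 j) ?(@coef_above n j) ?(@coef_above n.+2)//; try lia.
  case: j nj => // j nj; rewrite [X in X - _](coef_above (k := j))//; ring.
apply: (orthogonal_eq0 sq) => j; rewrite ltnS => jn.
rewrite /q mulrBl !mulrDl -!scalerAl linearB !linearD/= !functionalZ !orth_P.
rewrite (_ : n.+1 == j = false); last lia.
rewrite (_ : n.+2 == j = false); last lia.
rewrite [X in L X]mulrAC !mulr0n !mulr0 !subr0 oppr0 add0r functional_top; last first.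
  by rewrite (leq_trans (size_polyMleq _ _))// size_polyX size_P; lia.
rewrite coefXM/=; have [->|nj] := eqVneq n j.
  by rewrite coef_monic mul1r mulr1 mulfVK// subrr.
by rewrite coef_above ?mul0r ?mulr0 ?subrr//; lia.
Qed.

(* [D] is [- h_n] times the Christoffel-Darboux kernel at [z]. *)
Lemma christoffel_darboux n (z : R) : exists D : {poly R},
  [/\ (size D <= n.+1)%N,
      (z%:P - 'X) * D = (P n).[z] *: P n.+1 - (P n.+1).[z] *: P n
    & forall S : {poly R}, (size S <= n.+1)%N -> L (D * S) = - h n * S.[z]].
Proof.
have P0E := monic_size1_eq1 (size_P 0%N) (P_monic 0%N).
(* The reproducing property reduces to [S = 1]: write [S - S(z) = T ('X - z)] with [T] of degree
   below [n]; then [T] times the combination of [P n.+1] and [P n] is killed by [L]. *)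
suff [D [sD DE LD]] : exists D : {poly R}, [/\ (size D <= n.+1)%N,
    (z%:P - 'X) * D = (P n).[z] *: P n.+1 - (P n.+1).[z] *: P n
    & L D = - h n].
  exists D; split => // S sS.
  have /factor_theorem[T TE] : root (S - (S.[z])%:P) z.
    by rewrite rootE !hornerE subrr.
  have sT : (size T <= n)%N.
    have [->|T0] := eqVneq T 0; first by rewrite size_poly0.
    have : (size (T * ('X - z%:P))%R <= n.+1)%N.
      rewrite -TE (leq_trans (size_polyD _ _))// geq_max sS size_polyN.
      by rewrite (leq_trans (size_polyC_leq1 _)).
    by rewrite size_Mmonic ?monicXsubC// size_XsubC addn2.
  have -> : D * S = S.[z] *: D - T * ((z%:P - 'X) * D).
    rewrite -mul_polyC -{1}[S](subrK (S.[z])%:P) TE; ring.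
  rewrite linearB/= functionalZ LD DE mulrBr -!scalerAr linearB/= !functionalZ.
  by rewrite !functional_lower_eq0 ?(leq_trans sT)//; ring.
elim: n => [|n [D [sD DE LD]]].
  (* For [n = 0] the combination is [P 1 - (P 1).[z] = 'X - z]. *)
  exists (- 1); split.
  - by rewrite size_polyN size_poly1.
  - have /size_sub_lead/size1_polyC : (size ('X : {poly R})%R <= 1.+1)%N.
      by rewrite size_polyX.
    move: (_`_0%N) => c; rewrite coefX scale1r => cE.
    have -> : P 1%N = 'X - c%:P by rewrite -cE; ring.
    by rewrite P0E !hornerE scale1r -!mul_polyC rmorphB/=; ring.
  - have := orth_P 0%N 0%N; rewrite P0E mulr1 eqxx mulr1 => L1.
    by rewrite linearN/= L1.
(* Eliminating [P n.+2] and its value at [z] by the recurrence turns the combination into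
   [h n.+1 / h n] times the previous one, plus [(P n.+1).[z]] times [('X - z) P n.+1]; dividing by
   [z - 'X] gives this witness. *)
exists ((h n.+1 / h n) *: D - (P n.+1).[z] *: P n.+1); split.
- rewrite (leq_trans (size_polyD _ _))// geq_max size_polyN.
  rewrite (leq_trans (size_scale_leq _ _)) ?(leq_trans sD)//.
  by rewrite (leq_trans (size_scale_leq _ _))// size_P.
- rewrite mulrBr -!scalerAr DE mulrBl.
  have := congr1 (horner^~ z) (three_term n); rewrite !hornerE => Pz.
  rewrite three_term; move: Pz.
  move: (_ - _) (_ / _) => c b Pz.
  have -> : (P n.+2).[z] = z * (P n.+1).[z] - c * (P n.+1).[z] - b * (P n).[z].
    by rewrite Pz; ring.
  by rewrite -!mul_polyC !rmorphB !rmorphM/=; ring.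
- rewrite linearB/= !functionalZ LD -[P n.+1]mul1r functional_lower_eq0 ?size_poly1//.
  by rewrite mulr0 subr0 mulrN divfK.
Qed.

(** Removing the component along [P n.+1], which is orthogonal to [P n], leaves degree at most [n]
    and corrects the coefficient of index [n]. *)
Lemma functional_top2 n (q : {poly R}) : (size q <= n.+2)%N ->
  L (q * P n) = (q`_n - q`_n.+1 * subleading P n.+1) * h n.
Proof.
move=> sq; rewrite -[in LHS](subrK (q`_n.+1 *: P n.+1) q) mulrDl linearD/=.
rewrite functional_top ?size_sub_lead// -scalerAl functionalZ orth_P.
by rewrite (_ : n.+1 == n = false) ?mulr0n; [rewrite coefB coefZ/=; ring|lia].
Qed.

(** * Ladder identities from the Christoffel-Darboux kernel *)

Section kernel.
Context (n : nat) (z : R) (D : {poly R}).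
Hypothesis size_kernel : (size D <= n.+1)%N.
Hypothesis kernelE :
  (z%:P - 'X) * D = (P n).[z] *: P n.+1 - (P n.+1).[z] *: P n.
Hypothesis kernel_repr :
  forall S : {poly R}, (size S <= n.+1)%N -> L (D * S) = - h n * S.[z].

Local Notation phi := (@endpoint_poly R).

Let mul_phi (q : {poly R}) : q * phi = q * 'X - q * 'X * 'X.
Proof. by rewrite /endpoint_poly; ring. Qed.

Let phiE (q : {poly R}) : (q * phi).[z] = phi.[z] * q.[z].
Proof. by rewrite hornerM mulrC. Qed.

Lemma size_mul_phi k (q : {poly R}) :
  (size q <= k)%N -> (size (q * phi)%R <= k.+2)%N.
Proof.
move=> sq; apply/leq_sizeP => -[//|[//|j]] kj.
by rewrite mul_phi coefB !coefMX/= !nth_default ?subrr// (leq_trans sq)//; lia.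
Qed.

(** The coefficients of index [n.+1] and [n] in [kernelE] determine the two top coefficients of [D];
    multiplication by [phi] shifts them. *)
Lemma kernel_phi_coef :
  (D * phi)`_n.+2 = (P n).[z] /\
  (D * phi)`_n.+1 = (z + subleading P n.+1 - 1) * (P n).[z] - (P n.+1).[z].
Proof.
have D0 : D`_n.+1 = 0 by rewrite nth_default.
have := congr1 (fun q : {poly R} => q`_n.+1) kernelE.
have := congr1 (fun q : {poly R} => q`_n) kernelE.
rewrite mulrBl ['X * D]mulrC mul_polyC !coefB !coefZ !coef_monic.
rewrite (coef_above (n := n) (k := n.+1))// [(D * 'X)`_n.+1]coefMX/= D0 => E1 E2.
rewrite mul_phi !coefB !(coefMX _ n.+2) !(coefMX _ n.+1)/= D0.
have -> : D`_n = - (P n).[z] by apply/oppr_inj; move: E2; rewrite mulr0; lra.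
have -> : (D * 'X)`_n = z * D`_n - (P n).[z] * (P n.+1)`_n + (P n.+1).[z].
  by move: E1; lra.
have -> : D`_n = - (P n).[z] by apply/oppr_inj; move: E2; rewrite mulr0; lra.
by split; ring.
Qed.

(** [D] has degree at most [n], hence is orthogonal to [P n.+1] and [P n.+2]; once these components
    of [q] are removed, the remainder lies in the reproducing range. *)
Lemma kernel_repr2 (q : {poly R}) : (size q <= n.+3)%N ->
  L (D * q) = - h n * (q.[z] - q`_n.+2 * (P n.+2).[z]
    - (q`_n.+1 - q`_n.+2 * subleading P n.+2) * (P n.+1).[z]).
Proof.
move=> sq; set b := q`_n.+2; set a := _ - b * subleading _ _.
have [S sS qE] : exists2 S : {poly R}, (size S <= n.+1)%N &
    q = S + a *: P n.+1 + b *: P n.+2.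
  exists (q - b *: P n.+2 - a *: P n.+1); last by rewrite !subrK.
  have := @size_sub_lead n.+1 _ (@size_sub_lead n.+2 _ sq).
  by rewrite coefB coefZ.
have -> : q.[z] = S.[z] + a * (P n.+1).[z] + b * (P n.+2).[z].
  by rewrite qE !hornerE.
rewrite [in LHS]qE (mulrDr D) (mulrDr D) -!scalerAr !linearD/= !functionalZ.
rewrite kernel_repr// !functional_lower_eq0 ?(leq_trans size_kernel)//.
by ring.
Qed.

(** Product rule: [P n.+1] against the derivative of [D phi] sees only a leading coefficient and
    contributes [n + 2]; [D] against [phi P n.+1'] is evaluated by [kernel_repr2] and contributes
    [n + 1] through the recurrence. Together they form [2 * n.+1 + 1]. *)
Lemma ladder_lowering :
  h n * (phi.[z] * (P n.+1)^`().[z]) =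
    - L ((P n.+1 * D * phi)^`()) + (2 * n.+1 + 1)%:R * h n.+1 * (P n).[z]
    - h n * (n.+1%:R * (z - 1) - subleading P n.+1) * (P n.+1).[z].
Proof.
have [E2 E1] := kernel_phi_coef.
rewrite -mulrA derivM linearD/= [P n.+1 * _]mulrC functional_top; last first.
  exact/size_deriv_le/size_mul_phi.
rewrite coef_deriv E2 (mulrCA _ D) kernel_repr2; last first.
  by apply/size_mul_phi/size_deriv_le; rewrite size_P.
have q2 : ((P n.+1)^`() * phi)`_n.+2 = - n.+1%:R.
  rewrite mul_phi coefB !coefMX/= !coef_deriv coef_monic coef_above//; ring.
have q1 : ((P n.+1)^`() * phi)`_n.+1 = n.+1%:R - n%:R * subleading P n.+1.
  rewrite mul_phi coefB !coefMX/= !coef_deriv coef_monic.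
  by case: n => [|k]; rewrite ?coef_deriv/=; ring.
(* This elimination brings in [h n.+1] and cancels [subleading P n.+2]. *)
have PzE : (P n.+2).[z] = z * (P n.+1).[z] - h n.+1 / h n * (P n).[z]
    - (subleading P n.+1 - subleading P n.+2) * (P n.+1).[z].
  by have := congr1 (horner^~ z) (three_term n); rewrite !hornerE => ->; ring.
rewrite phiE q1 q2 PzE.
by rewrite -[(P n.+1)`_n]/(subleading P n.+1); field; exact: h_neq0.
Qed.

(** Same product rule with [P n]: the derivative of [D phi] now has degree one above [n], so its two
    top coefficients enter. The multiples [n + 1] and [n] of [(P n.+1).[z]] from the two terms add
    up to [2 * n + 1]. *)
Lemma ladder_raising :
  h n * (phi.[z] * (P n)^`().[z]) =
    - L ((P n * D * phi)^`()) - (2 * n + 1)%:R * h n * (P n.+1).[z]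
    + h n * (n.+1%:R * (z - 1) - subleading P n.+1) * (P n).[z].
Proof.
have [E2 E1] := kernel_phi_coef.
rewrite -mulrA derivM linearD/= [P n * _]mulrC functional_top2; last first.
  exact/size_deriv_le/size_mul_phi.
have sq : (size ((P n)^`() * phi)%R <= n.+2)%N.
  by apply/size_mul_phi/size_deriv_le; rewrite size_P.
rewrite !coef_deriv E2 E1 (mulrCA _ D) kernel_repr2 ?(leq_trans sq)//.
have q2 : ((P n)^`() * phi)`_n.+2 = 0 by rewrite nth_default.
have q1 : ((P n)^`() * phi)`_n.+1 = - n%:R.
  rewrite mul_phi coefB !coefMX/= !coef_deriv.
  rewrite coef_above ?mul0rn//; case: n => [|k]; first by rewrite subr0 oppr0.
  by rewrite /= coef_monic; ring.
by rewrite phiE q1 q2 -[(P n.+1)`_n]/(subleading P n.+1); ring.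
Qed.
End kernel.
End orthogonal_algebra.

(** * Fundamental theorem of calculus with end-point singularities and jumps *)

Section integration.
Context {R : realType}.
Local Notation mu := (@lebesgue_measure R).

(** The integrand may blow up at [a] and [b]. Its indefinite integral [G] is still continuous on the
    closed interval, and [F - G] has zero derivative inside, so the mean value theorem makes its end
    values equal. *)
Lemma integrable_FTC2 (f F : R -> R) (a b : R) : a <= b ->
  mu.-integrable `[a, b] (EFin \o f) -> {within `[a, b], continuous F} ->
  {in `]a, b[, forall x : R, is_derive x 1 F (f x)} ->
  {in `]a, b[, continuous f} ->
  \int[mu]_(x in `[a, b]) f x = F b - F a.
Proof.
move=> ab intf cF dF cf; pose G x := \int[mu]_(t in `[a, x]) f t.
have cG : {within `[a, b], continuous G}.
  exact: (parameterized_integral_continuous ab intf).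
have [||c cab] := @MVT_segment R (F \- G) (cst 0) a b ab.
- move=> x xab; have /andP[ax xb] : a < x < b by move: xab; rewrite in_itv.
  have [dG GE] := continuous_FTC1_closed xb intf ax (cf x xab).
  have dGx : is_derive x 1 G (f x).
    by apply: DeriveDef; [exact: dG|rewrite -derive1E; exact: GE].
  rewrite /= -(subrr (f x)); have := dF x xab => dFx; exact: is_deriveB.
- by apply: within_continuousB.
- rewrite /= mul0r /G set_itv1 Rintegral_set1; lra.
Qed.

Lemma integrable_itv_obnd_cbnd (f : R -> R) (a : R) (b : itv_bound R) :
  mu.-integrable [set` Interval (BRight a) b] (EFin \o f) ->
  mu.-integrable [set` Interval (BLeft a) b] (EFin \o f).
Proof.
move=> /integrableP[mf fi]; apply/integrableP; split.
  exact/emeasurable_fun_itv_obnd_cbndP.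
by rewrite -integral_itv_obnd_cbnd//; exact: measurableT_comp.
Qed.

(** The jump factor of [jump_weight], isolated because it is piecewise constant and passes through
    the integration by parts. *)
Definition step_fun (m : nat) (omega t : nat -> R) (x : R) : R :=
  omega 0%N + \sum_(1 <= k < m.+1) omega k * heaviside (x - t k).

(* Only [g * step_fun] is assumed integrable: where the step function vanishes,
   [g] alone may fail to be integrable near the end points. *)
Lemma integral_mul_step (g F : R -> R) (m : nat) (omega t : nat -> R) (c : R) :
  {within `[0, 1], continuous F} ->
  {in `]0, 1[, forall x : R, is_derive x 1 F (g x)} ->
  {in `]0, 1[, continuous g} ->
  (forall k, (1 <= k <= m)%N -> 0 <= t k <= c) ->
  (forall j k, (1 <= j)%N -> (j < k)%N -> (k <= m)%N -> t j < t k) ->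
  0 <= c <= 1 ->
  mu.-integrable `[0, c] (EFin \o (fun x => g x * step_fun m omega t x)) ->
  \int[mu]_(x in `[0, c]) (g x * step_fun m omega t x) =
    (\sum_(0 <= k < m.+1) omega k) * F c - omega 0%N * F 0
    - \sum_(1 <= k < m.+1) omega k * F (t k).
Proof.
move=> cF dF cg.
have piece (u v s : R) : 0 <= u -> u <= v -> v <= 1 ->
    mu.-integrable `[u, v] (EFin \o (fun x => g x * s)) ->
    \int[mu]_(x in `[u, v]) (g x * s) = s * (F v - F u).
  move=> u0 uv v1 intg; rewrite (@integrable_FTC2 _ (fun x => F x * s) u v)//.
  - ring.
  - apply: continuous_subspaceW (_ : `[u, v] `<=` `[0, 1]) _.
      by apply: subset_itvScc; rewrite bnd_simp.
    move=> x; apply: cvgM; [exact: cF|exact: cvg_cst].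
  - move=> x xuv; have x01 : x \in `]0, 1[.
      by apply: subset_itvSoo xuv; rewrite bnd_simp.
    have := dF x x01 => dFx.
    have -> : (fun y => F y * s) = s *: F by apply/funext => y; rewrite mulrC.
    by rewrite mulrC; exact: is_deriveZ.
  - move=> x xuv; have x01 : x \in `]0, 1[.
      by apply: subset_itvSoo xuv; rewrite bnd_simp.
    by apply: continuousM; [exact: cg|exact: cvg_cst].
(* Induction with [c] general: cut at the last jump. Left of it, and at it since [heaviside 0 = 0],
   the last summand vanishes and the hypothesis applies with [t m.+1] as the new end; right of it
   the step function is constant. *)
elim: m c => [|m IH] c tc tS /andP[c0 c1] intg.
  have E x : step_fun 0 omega t x = omega 0%N by rewrite /step_fun big_geq// addr0.
  under [in LHS]eq_Rintegral do rewrite E.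
  rewrite piece//; first by rewrite big_nat1 big_geq//; ring.
  by apply: eq_integrable intg => // x _; rewrite /= E.
have /andP[t0 tcm] : 0 <= t m.+1 <= c by apply: tc; rewrite ltnS leqnn.
have El x : x <= t m.+1 -> step_fun m.+1 omega t x = step_fun m omega t x.
  move=> xt; rewrite /step_fun big_nat_recr//= /heaviside subr_gt0 ltNge xt/=; ring.
have Er x : t m.+1 < x -> step_fun m.+1 omega t x = \sum_(0 <= k < m.+2) omega k.
  move=> xt; rewrite /step_fun [in RHS]big_nat_recl//=; congr (_ + _).
  transitivity (\sum_(1 <= k < m.+2) omega k); last by rewrite big_add1.
  apply: eq_big_nat => k /andP[k1 km].
  have tk : t k <= t m.+1.
    have [->//|km'] := eqVneq k m.+1; apply: ltW; apply: tS => //; lia.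
  by rewrite /heaviside subr_gt0 (le_lt_trans tk xt) mulr1.
have intl : mu.-integrable `[0, t m.+1]
    (EFin \o (fun x => g x * step_fun m.+1 omega t x)).
  by apply: integrableS intg => //; apply: subset_itvl; rewrite bnd_simp.
have intr : mu.-integrable `]t m.+1, c]
    (EFin \o (fun x => g x * step_fun m.+1 omega t x)).
  by apply: integrableS intg => //; apply: subset_itvr; rewrite bnd_simp.
have := Rintegral_itvB intg (x := t m.+1); rewrite !bnd_simp => /(_ t0 tcm).
move/eqP; rewrite subr_eq => /eqP ->.
have -> : \int[mu]_(x in `]t m.+1, c]) (g x * step_fun m.+1 omega t x) =
    (\sum_(0 <= k < m.+2) omega k) * (F c - F (t m.+1)).
  have intr' : mu.-integrable `]t m.+1, c]
      (EFin \o (fun x => g x * \sum_(0 <= k < m.+2) omega k)).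
    apply: eq_integrable intr => // x; rewrite inE/= in_itv/= => /andP[tx _].
    by rewrite Er.
  transitivity (\int[mu]_(x in `]t m.+1, c]) (g x * \sum_(0 <= k < m.+2) omega k)).
    apply: eq_Rintegral => x; rewrite inE/= in_itv/= => /andP[tx _].
    by rewrite Er.
  rewrite Rintegral_itv_obnd_cbnd// piece//.
  exact: integrable_itv_obnd_cbnd.
have -> : \int[mu]_(x in `[0, t m.+1]) (g x * step_fun m.+1 omega t x) =
    (\sum_(0 <= k < m.+1) omega k) * F (t m.+1) - omega 0%N * F 0
    - \sum_(1 <= k < m.+1) omega k * F (t k).
  rewrite -IH.
  - apply: eq_Rintegral => x; rewrite inE/= in_itv/= => /andP[_ tx].
    by rewrite El.
  - move=> k /andP[k1 km]; have /andP[-> _] : 0 <= t k <= c by apply: tc; lia.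
    by apply: ltW; apply: tS => //; lia.
  - by move=> j k j1 jk km; apply: tS => //; lia.
  - by rewrite t0 (le_trans tcm).
  - apply: eq_integrable intl => // x; rewrite inE/= in_itv/= => /andP[_ tx].
    by rewrite El.
by rewrite !(@big_nat_recr _ _ _ m.+1)//=; ring.
Qed.
End integration.

(** * Derivative, potential and end-point behaviour of the Jacobi-type weight *)

Section derivatives.
Context {R : realType}.
Implicit Types (f g w : R -> R) (x : R).

Lemma is_derive1_chain f g x (df dg : R) :
  is_derive (f x) 1 g dg -> is_derive x 1 f df ->
  is_derive x 1 (g \o f) (dg * df).
Proof.
move=> gfx fx; apply: DeriveDef.
  apply/derivable1_diffP/differentiable_comp; apply/derivable1_diffP.
    exact: ex_derive.
  exact: ex_derive.
rewrite -derive1E derive1_comp; [|exact: ex_derive..].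
by rewrite !derive1E !derive_val.
Qed.

Lemma derive1_potential w x (dw : R) : 0 < w x -> is_derive x 1 w dw ->
  derive1 (potential w) x = - (dw / w x).
Proof.
move=> wx dwx; have lnw := is_derive1_chain (is_derive1_ln wx) dwx.
have := is_deriveN lnw => H; rewrite derive1E.
have -> : potential w = - (@ln R \o w) by [].
by rewrite derive_val mulrC.
Qed.

Context (a b : R) (w0 : R -> R).
Hypothesis dw0 : {in `]0, 1[, forall x : R, derivable w0 x 1}.
Hypothesis cw0 : {in `]0, 1[, continuous (derive1 w0)}.
Hypothesis w0_gt0 : {in `]0, 1[, forall x : R, 0 < w0 x}.
Local Notation w := (jacobi_weight a b w0).

Lemma jacobi_weight_gt0 : {in `]0, 1[, forall x : R, 0 < w x}.
Proof.
move=> x x01; have := w0_gt0 x01; move: x01; rewrite in_itv/= => /andP[x0 x1] wx.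
by rewrite !mulr_gt0 ?powR_gt0 ?subr_gt0.
Qed.

Let logder x : R := a / x - b / (1 - x) + derive1 w0 x / w0 x.

(** Puts the power rule in logarithmic form, so that the weight itself factors out of the product
    rule. *)
Lemma powR_logder x c : 0 < x -> c * x `^ (c - 1) = c / x * x `^ c.
Proof.
move=> x0; have -> : x `^ c = x `^ (c - 1) * x.
  by rewrite -{3}(powRr1 (ltW x0)) -powRD ?subrK// (lt0r_neq0 x0) implybT.
by field; exact: lt0r_neq0.
Qed.

Let is_derive_jacobi_logder x : x \in `]0, 1[ ->
  is_derive x 1 w (logder x * w x).
Proof.
move=> x01; have wx := w0_gt0 x01; have dwx := derivableP (dw0 x01).
move: x01; rewrite in_itv/= => /andP[x0 x1].
have x1' : 0 < 1 - x by rewrite subr_gt0.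
have d1 : is_derive x 1 (fun y : R => 1 - y) (-1).
  have -> : (fun y : R => 1 - y) = cst 1 - id by [].
  by apply: is_derive_eq; rewrite sub0r.
have db : is_derive x 1 (fun y : R => (1 - y) `^ b) (b * (1 - x) `^ (b - 1) * -1).
  exact: (is_derive1_chain (f := fun y => 1 - y) (@is_derive1_powR R b _ x1')).
have da := @is_derive1_powR R a x x0.
have -> : w = (((@powR R) ^~ a) * (fun y : R => (1 - y) `^ b)) * w0 by [].
apply: is_derive_eq; rewrite !powR_logder// /logder -derive1E.
rewrite /jacobi_weight /= !fctE.
set u := x `^ a; set v := (1 - x) `^ b.
rewrite -![_ *: _]/(_ * _).
by field; rewrite !lt0r_neq0.
Qed.

Lemma is_derive_jacobi x : x \in `]0, 1[ ->
  is_derive x 1 w (- derive1 (potential w) x * w x).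
Proof.
move=> x01; have dwx := is_derive_jacobi_logder x01.
have wx := jacobi_weight_gt0 x01.
by rewrite (derive1_potential wx dwx) mulfK ?lt0r_neq0// opprK.
Qed.

(** The derivative of the potential agrees with [- logder] near each interior point, and [logder] is
    visibly continuous there. *)
Lemma continuous_jacobi_potential :
  {in `]0, 1[, continuous (derive1 (potential w))}.
Proof.
move=> x x01; have E : {near x, (fun y => - logder y) =1 derive1 (potential w)}.
  near=> y; have y01 : y \in `]0, 1[ by near: y; exact: near_in_itvoo.
  have wy := jacobi_weight_gt0 y01.
  by rewrite (derive1_potential wy (is_derive_jacobi_logder y01)) mulfK ?lt0r_neq0.
rewrite /continuous_at -(nbhs_singleton E).
apply: cvg_trans (near_eq_cvg E) _ => //.
have w0x := w0_gt0 x01; have c0 := cw0 x01.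
have c1 : {for x, continuous w0}.
  exact/differentiable_continuous/derivable1_diffP/dw0.
move: x01; rewrite in_itv/= => /andP[x0 x1].
apply: cvgN; apply: cvgD; last first.
  by apply: cvgM => //; apply: cvgV => //; exact: lt0r_neq0.
apply: cvgB; apply: cvgMl_tmp; apply: cvgV; rewrite ?lt0r_neq0 ?subr_gt0//.
by apply: cvgB => //; exact: cvg_cst.
Unshelve. all: by end_near. Qed.

Hypothesis a_gtN1 : -1 < a.
Hypothesis b_gtN1 : -1 < b.
Hypothesis w0_bnd0 : bounded_near w0 (0 : R)^'+.
Hypothesis w0_bnd1 : bounded_near w0 (1 : R)^'-.

(** [phi] raises both exponents by one, making them positive. *)
Let norm_phi_jacobi x : x \in `]0, 1[ ->
  `|(x - x ^+ 2) * w x| = x `^ (a + 1) * (1 - x) `^ (b + 1) * `|w0 x|.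
Proof.
rewrite in_itv/= => /andP[x0 x1]; have x1' : 0 < 1 - x by rewrite subr_gt0.
rewrite !powRD ?(lt0r_neq0 x0) ?(lt0r_neq0 x1') ?implybT// !powRr1 ?ltW//.
rewrite !normrM (ger0_norm (powR_ge0 _ _)) (ger0_norm (powR_ge0 _ _)).
by rewrite ger0_norm; [ring|nra].
Qed.

Let powR_le1 x (c : R) : 0 <= x <= 1 -> 0 <= c -> x `^ c <= 1.
Proof.
move=> /andP[x0 x1] c0; have : x `^ c <= 1 `^ c by rewrite ge0_ler_powR// nnegrE.
by rewrite powR1.
Qed.

Let cvg_onem_at_left1 : (fun x : R => 1 - x) @ 1^'- --> 0^'+.
Proof.
move=> A [e /= e0 eA]; exists e => //= x /= xe x1; apply: eA => /=.
  by rewrite sub0r normrN.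
by rewrite subr_gt0.
Qed.

(** At each end the function is squeezed between 0 and a bound of [w0] times a positive power of the
    distance to that end. *)
Lemma continuous_phi_jacobi :
  {within `[0, 1], continuous (fun x => (x - x ^+ 2) * w x)}.
Proof.
have a1 : 0 <= a + 1 by rewrite -lerBlDr sub0r ltW.
have b1 : 0 <= b + 1 by rewrite -lerBlDr sub0r ltW.
apply/(continuous_within_itvP _ ltr01); split.
- move=> x x01; apply: cvgM.
    apply: cvgB; first exact: cvg_id.
    exact: exprn_continuous.
  apply/differentiable_continuous/derivable1_diffP.
  have := is_derive_jacobi x01 => H; exact: ex_derive.
- rewrite expr0n subrr mul0r; have /ex_bound[M w0M] := w0_bnd0.
  apply/norm_cvg0P; apply: (@squeeze_cvgr _ _ _ _ (cst 0) (fun x => x `^ (a + 1) * M)).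
  + near=> x; have x0 : 0 < x by [].
    have x1 : x < 1 by near: x; exact: nbhs_right_lt.
    rewrite normr_ge0/= norm_phi_jacobi ?in_itv/= ?x0//.
    rewrite ler_pM ?mulr_ge0 ?powR_ge0//; last by near: x.
    by rewrite ler_piMr ?powR_ge0// powR_le1// subr_ge0 lerBlDr lerDl !ltW.
  + exact: cvg_cst.
  + rewrite -[X in _ --> X](mul0r M); apply: cvgMr_tmp.
    by apply: powR_cvg0; rewrite -ltrBlDr sub0r.
- rewrite expr1n subrr mul0r; have /ex_bound[M w0M] := w0_bnd1.
  apply/norm_cvg0P; apply: (@squeeze_cvgr _ _ _ _ (cst 0)
    (fun x => (1 - x) `^ (b + 1) * M)).
  + near=> x; have x1 : x < 1 by [].
    have x0 : 0 < x by near: x; exact: nbhs_left_gt.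
    rewrite normr_ge0/= norm_phi_jacobi ?in_itv/= ?x0//.
    rewrite ler_pM ?mulr_ge0 ?powR_ge0//; last by near: x.
    by rewrite ler_piMl ?powR_ge0// powR_le1// !ltW.
  + exact: cvg_cst.
  + rewrite -[X in _ --> X](mul0r M); apply: cvgMr_tmp.
    apply: (cvg_comp (fun x : R => 1 - x) (fun y => y `^ (b + 1)) cvg_onem_at_left1).
    by apply: powR_cvg0; rewrite -ltrBlDr sub0r.
Unshelve. all: by end_near. Qed.
End derivatives.

(** * Moment functionals and integration by parts against the jump weight *)

Section moments.
Context {R : realType}.
Local Notation mu := (@lebesgue_measure R).

Lemma integrable_poly_mul (p : {poly R}) (f : R -> R) :
  mu.-integrable `[0, 1] (EFin \o f) ->
  mu.-integrable `[0, 1] (EFin \o (fun x => p.[x] * f x)).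
Proof.
move=> intf; have bp : [bounded p.[x] | x in (`[0, 1]%classic : set R)].
  have /compact_bounded[M [Mr pM]] : compact (horner p @` `[0, 1]).
    apply: continuous_compact; last exact: segment_compact.
    by apply: continuous_subspaceT; exact: continuous_horner.
  by exists M; split=> // N MN x x01; apply: pM MN _ _; exists x.
have mp : measurable_fun (`[0, 1]%classic : set R) (horner p).
  apply: measurable_funTS; apply: continuous_measurable_fun.
  exact: continuous_horner.
have : mu.-integrable `[0, 1] ((EFin \o horner p) \* (EFin \o f))%E.
  exact: integrableMr.
by apply: eq_integrable.
Qed.

Lemma measurable_heaviside (D : set R) (t : R) :
  measurable_fun D (fun x => heaviside (x - t)).
Proof.
have -> : (fun x => heaviside (x - t)) = \1_(`]t, +oo[%classic : set R).
  by apply/funext => x; rewrite indicE mem_setE in_itv/= andbT /heaviside subr_gt0.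
by apply: measurable_indic.
Qed.

Lemma measurable_step m omega t (D : set R) : measurable_fun D (@step_fun R m omega t).
Proof.
apply: measurable_funD; first exact: measurable_cst.
apply: measurable_sum => k; apply: measurable_funM; first exact: measurable_cst.
exact: measurable_heaviside.
Qed.

Lemma bounded_step m omega t (D : set R) : [bounded step_fun m omega t x | x in D].
Proof.
exists (`|omega 0%N| + \sum_(1 <= k < m.+1) `|omega k|).
split; first exact: num_real.
move=> M /ltW ltM x _ /=; apply: le_trans ltM; rewrite /step_fun.
rewrite (le_trans (ler_normD _ _))// lerD2l (le_trans (ler_norm_sum _ _ _))//.
apply: ler_sum => k _; rewrite normrM ler_piMr// /heaviside.
by case: (0 < _); rewrite ?normr0 ?normr1.
Qed.

Lemma integrable_jump_weight (wJS : R -> R) m omega t :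
  mu.-integrable `[0, 1] (EFin \o wJS) ->
  mu.-integrable `[0, 1] (EFin \o jump_weight wJS m omega t).
Proof.
move=> intw.
have : mu.-integrable `[0, 1] ((EFin \o wJS) \* (EFin \o step_fun m omega t))%E.
  apply: integrableMl => //; first exact: measurable_step.
  exact: bounded_step.
by apply: eq_integrable.
Qed.

(** Used with [f] the jump weight and with [f] the ladder kernel times that weight. *)
Definition moment_functional (f : R -> R) (p : {poly R}) : R :=
  \int[mu]_(x in `[0, 1]) (p.[x] * f x).

Lemma moment_functional_linear (f : R -> R) :
  mu.-integrable `[0, 1] (EFin \o f) ->
  linear (moment_functional f : {poly R} -> R^o).
Proof.
move=> intf c p q; rewrite -[RHS]/(c * _ + _) /moment_functional.
rewrite -RintegralZl//; last exact: integrable_poly_mul.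
rewrite -RintegralD//.
- by apply: eq_Rintegral => x _; rewrite hornerD hornerZ mulrDl mulrA.
- have := integrable_poly_mul (c *: p) intf; apply: eq_integrable => // x _.
  by rewrite /= hornerE mulrA.
- exact: integrable_poly_mul.
Qed.

Local Notation phi := (@endpoint_poly R).

Lemma moment_ladder_kernel (a b : R) (w0 : R -> R) (m : nat)
    (omega t : nat -> R) (z : R) (q : {poly R})
    (wJS := jacobi_weight a b w0) (w := jump_weight wJS m omega t) :
  -1 < a -> -1 < b ->
  {in `]0, 1[, forall x : R, derivable w0 x 1} ->
  {in `]0, 1[, continuous (derive1 w0)} ->
  {in `]0, 1[, forall x : R, 0 < w0 x} ->
  bounded_near w0 (0 : R)^'+ -> bounded_near w0 (1 : R)^'- ->
  mu.-integrable `[0, 1] (EFin \o wJS) ->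
  (forall k, (1 <= k <= m)%N -> 0 <= t k <= 1) ->
  (forall j k, (1 <= j)%N -> (j < k)%N -> (k <= m)%N -> t j < t k) ->
  ladder_convergent wJS m omega t z ->
  moment_functional (fun x => ladder_kernel (potential wJS) z x * w x)
      ((z%:P - 'X) * q) =
    phi.[z] * derive1 (potential wJS) z * moment_functional w q
    - moment_functional w ((q * phi)^`())
    - \sum_(1 <= k < m.+1) omega k * (q.[t k] * phi.[t k] * wJS (t k)).
Proof.
move=> a1 b1 dw0 cw0 w0_gt0 bnd0 bnd1 intJS t01 tS lc.
have intw := integrable_jump_weight m omega t intJS.
pose v' : R -> R := derive1 (potential wJS).
(* [F] is [q phi wJS], and [g] its derivative on []0, 1[], by [wJS' = - v' wJS]. *)
pose F x := q.[x] * ((x - x ^+ 2) * wJS x).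
pose g x := (q * phi)^`().[x] * wJS x - q.[x] * phi.[x] * v' x * wJS x.
have phiE x : phi.[x] = x - x ^+ 2 by rewrite /endpoint_poly !hornerE.
have kz x : ((z%:P - 'X) * q).[x] * (ladder_kernel (potential wJS) z x * w x) =
    phi.[z] * v' z * (q.[x] * w x) - q.[x] * phi.[x] * v' x * w x.
  rewrite hornerM hornerD hornerN hornerC hornerX /ladder_kernel -/v' !phiE.
  (* At [x = z] the kernel is [0 / 0 = 0] and both sides vanish. *)
  have [->|zx] := eqVneq z x.
    by rewrite subrr; ring.
  by field; rewrite subr_eq0.
(* Integrability of [g * step_fun] comes from this form: the singular part is controlled by
   [ladder_convergent] as a whole, the rest by the moments. *)
have gE x : g x * step_fun m omega t x =
    ((z%:P - 'X) * q).[x] * (ladder_kernel (potential wJS) z x * w x)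
    - phi.[z] * v' z * (q.[x] * w x) + (q * phi)^`().[x] * w x.
  by rewrite kz /g /w /jump_weight -/(step_fun m omega t x); ring.
have iK := integrable_poly_mul ((z%:P - 'X) * q) lc.
have iq := integrable_poly_mul ((phi.[z] * v' z) *: q) intw.
have iq' := integrable_poly_mul ((q * phi)^`()) intw.
have cF : {within `[0, 1], continuous F}.
  have cphi : {within `[0, 1], continuous (fun x => (x - x ^+ 2) * wJS x)}.
    exact: continuous_phi_jacobi.
  move=> x; apply: cvgM; last exact: cphi.
  exact: (continuous_subspaceT (@continuous_horner _ q)).
have dF : {in `]0, 1[, forall x : R, is_derive x 1 F (g x)}.
  move=> x x01; have dw := is_derive_jacobi a b dw0 w0_gt0 x01.
  have dp : is_derive x 1 (horner (q * phi)) ((q * phi)^`().[x]).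
    by apply: DeriveDef; [exact: derivable_horner|rewrite -derive1E -derivE].
  have -> : F = horner (q * phi) * wJS.
    by apply/funext => y; rewrite /F fctE hornerM phiE mulrA.
  by apply: is_derive_eq; rewrite -![_ *: _]/(_ * _) /g hornerM -/v' -/wJS; ring.
have cg : {in `]0, 1[, continuous g}.
  move=> x x01; have dw := is_derive_jacobi a b dw0 w0_gt0 x01.
  have cw : {for x, continuous wJS}.
    by apply/differentiable_continuous/derivable1_diffP; exact: ex_derive.
  have cv : {for x, continuous v'}.
    exact: continuous_jacobi_potential.
  apply: cvgB; apply: cvgM => //; first exact: continuous_horner.
  apply: cvgM; last exact: cv.
  by apply: cvgM; exact: continuous_horner.
have igs : mu.-integrable `[0, 1] (EFin \o (fun x => g x * step_fun m omega t x)).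
  apply: eq_integrable (integrableD _ (integrableB _ iK iq) iq') => // x _.
  by rewrite /= -!EFinD hornerZ gE -mulrA.
have := @integral_mul_step R g F m omega t 1 cF dF cg t01 tS _ igs.
rewrite ler01 lexx => /(_ isT).
(* [phi] vanishes at both ends, so only the jump terms survive. *)
have -> : F 1 = 0 by rewrite /F expr1n subrr mul0r mulr0.
have -> : F 0 = 0 by rewrite /F expr0n subrr mul0r mulr0.
rewrite !mulr0 subr0 sub0r => E.
have -> : \sum_(1 <= k < m.+1) omega k * (q.[t k] * phi.[t k] * wJS (t k)) =
    - \int[mu]_(x in `[0, 1]) (g x * step_fun m omega t x).
  by rewrite E opprK; apply: eq_bigr => k _; rewrite /F phiE !mulrA.
have -> : \int[mu]_(x in `[0, 1]) (g x * step_fun m omega t x) =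
    moment_functional (fun x => ladder_kernel (potential wJS) z x * w x)
      ((z%:P - 'X) * q) - moment_functional w ((phi.[z] * v' z) *: q)
    + moment_functional w ((q * phi)^`()).
  rewrite /moment_functional -RintegralB// -RintegralD//; last first.
    by apply: eq_integrable (integrableB _ iK iq).
  by apply: eq_Rintegral => x _; rewrite gE hornerZ !mulrA.
have -> : moment_functional w ((phi.[z] * v' z) *: q) =
    phi.[z] * v' z * moment_functional w q.
  rewrite /moment_functional -RintegralZl//; last exact: integrable_poly_mul.
  by apply: eq_Rintegral => x _; rewrite hornerZ -!mulrA.
by rewrite -/v'; ring.
Qed.
End moments.

(** * Assembly of the two ladder relations *)

Theorem theorem5p3 (R : realType) (a b : R) (w0 : R -> R) (m : nat)
    (omega t : nat -> R) (P : nat -> {poly R}) (h : nat -> R)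
    (wJS := jacobi_weight a b w0)
    (A := ladderA wJS m omega t P h)
    (B := ladderB wJS m omega t P h) :
  -1 < a -> -1 < b ->
  {in `]0, 1[, forall x : R, derivable w0 x 1} ->
  {in `]0, 1[, continuous (derive1 w0)} ->
  {in `]0, 1[, forall x : R, 0 < w0 x} ->
  bounded_near w0 (0 : R)^'+ -> bounded_near w0 (1 : R)^'- ->
  (forall j : nat, lebesgue_measure.-integrable `[0, 1]
     (EFin \o (fun x : R => x ^+ j * wJS x))) ->
  (forall k, (1 <= k <= m)%N -> 0 <= t k <= 1) ->
  (forall j k, (1 <= j)%N -> (j < k)%N -> (k <= m)%N -> t j < t k) ->
  (forall l, (l <= m)%N -> 0 <= \sum_(0 <= k < l.+1) omega k) ->
  monic_orthogonal (jump_weight wJS m omega t) P h ->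
  forall (n : nat) (z : R),
    0 < z < 1 ->
    (forall k, (1 <= k <= m)%N -> z != t k) ->
    ladder_convergent wJS m omega t z ->
    ((P n)^`()).[z] =
      - B n z * (P n).[z] + rec_beta h n * A n z * (preceding P n).[z]
    /\
    ((preceding P n)^`()).[z] =
      (B n z + derive1 (potential wJS) z) * (preceding P n).[z]
      - preceding (A ^~ z) n * (P n).[z].
Proof.
move=> a1 b1 dw0 cw0 w0_gt0 bnd0 bnd1 intj t01 tS _ [size_P P_monic orth_P h_gt0].
move=> n z /andP[z0 z1] zt lc.
have P0E := monic_size1_eq1 (size_P 0%N) (P_monic 0%N).
(* For index 0 both relations read [0 = 0], by [P 0 = 1] and the conventions. Afterwards the index
   is [n.+1], and [D] pairs [P n.+1] with [P n]. *)
case: n => [|n].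
  by rewrite /= P0E derivC deriv0 !horner0 /B/=; split; ring.
have intJS : lebesgue_measure.-integrable `[0, 1] (EFin \o wJS).
  by apply: eq_integrable (intj 0%N) => // x _; rewrite /= expr0 mul1r.
set w := jump_weight wJS m omega t in orth_P.
have intw : lebesgue_measure.-integrable `[0, 1] (EFin \o w).
  exact: integrable_jump_weight.
pose L : {linear {poly R} -> R^o} := HB.pack (moment_functional w : {poly R} -> R^o)
  (GRing.isLinear.Build R {poly R} R^o *:%R _ (moment_functional_linear intw)).
pose f x := ladder_kernel (potential wJS) z x * w x.
pose J : {linear {poly R} -> R^o} := HB.pack (moment_functional f : {poly R} -> R^o)
  (GRing.isLinear.Build R {poly R} R^o *:%R _ (moment_functional_linear lc)).
have Lorth i j : L (P i * P j) = h j * (i == j)%:R.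
  by rewrite -orth_P; apply: eq_Rintegral => x _; rewrite hornerM.
have h_neq0 k : h k != 0 by rewrite lt0r_neq0.
have [D [sD DE DR]] := christoffel_darboux size_P P_monic Lorth h_neq0 n z.
have low := ladder_lowering size_P P_monic Lorth h_neq0 sD DE DR.
have rai := ladder_raising size_P P_monic Lorth sD DE DR.
have ibp q := moment_ladder_kernel q a1 b1 dw0 cw0 w0_gt0 bnd0 bnd1 intJS t01 tS lc.
have ibp1 := ibp (P n.+1 * D); have ibp0 := ibp (P n * D).
have Jmul (p : {poly R}) : moment_functional f ((z%:P - 'X) * (p * D)) =
    (P n).[z] * moment_functional f (p * P n.+1)
    - (P n.+1).[z] * moment_functional f (p * P n).
  rewrite mulrCA DE mulrBr -!scalerAr.
  by rewrite -[LHS]/(J _) linearB !(functionalZ J).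
(* These moments multiply [v'(z)]: the first is 0, so the lowering relation has no such term; the
   second produces the [v'(z)] of the raising relation. *)
have DR0 : moment_functional w (P n.+1 * D) = 0.
  by rewrite mulrC; exact: (functional_lower_eq0 size_P P_monic Lorth sD).
have DR1 : moment_functional w (P n * D) = - h n * (P n).[z].
  by rewrite mulrC; apply: DR; rewrite size_P.
have phiE x : endpoint_poly.[x] = x - x ^+ 2 :> R by rewrite /endpoint_poly !hornerE.
have phiz : z - z ^+ 2 != 0.
  by rewrite -[z - _](_ : z * (1 - z) = _) ?mulf_neq0 ?lt0r_neq0 ?subr_gt0//; ring.
(* The jump sums of [A] and [B] without their factor [1 / h], symmetric in [p] and [q]. *)
pose S p q := \sum_(1 <= k < m.+1) (t k - t k ^+ 2) *
  (omega k * wJS (t k) * p.[t k] * q.[t k]) / (z - t k).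
have SC p q : S p q = S q p by apply: eq_bigr => k _; ring.
(* Evaluating [DE] at [t k] and dividing by [z - t k], nonzero by hypothesis, gives [D.[t k]]. *)
have sumE (p : {poly R}) :
    \sum_(1 <= k < m.+1) omega k * ((p * D).[t k] * endpoint_poly.[t k] * wJS (t k)) =
    (P n).[z] * S p (P n.+1) - (P n.+1).[z] * S p (P n).
  rewrite !mulr_sumr -sumrB; apply: eq_big_nat => k /andP[k1 km].
  have ztk : z - t k != 0 by rewrite subr_eq0; apply: zt; rewrite k1.
  have := congr1 (horner^~ (t k)) DE.
  rewrite hornerM hornerD hornerN hornerC hornerX hornerD hornerN !hornerZ => Dtk.
  rewrite hornerM (_ : D.[t k] = ((P n).[z] * (P n.+1).[t k]
    - (P n.+1).[z] * (P n).[t k]) / (z - t k)); last by rewrite -Dtk mulrC mulKf.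
  by rewrite phiE; ring.
have AE j : A j z = (z - z ^+ 2)^-1 * ((h j)^-1 * moment_functional f (P j * P j)
    + (2 * j + 1)%:R + (h j)^-1 * S (P j) (P j)).
  rewrite /A /ladderA; congr (_ * (_ * _ + _ + _)).
    by apply: eq_Rintegral => x _; rewrite hornerM /f /w; ring.
  by rewrite mulr_sumr; apply: eq_bigr => k _; rewrite /Rhat; ring.
have BE : B n.+1 z = (z - z ^+ 2)^-1 * ((h n)^-1 * moment_functional f (P n.+1 * P n)
    + n.+1%:R * (z - 1) - subleading P n.+1 + (h n)^-1 * S (P n.+1) (P n)).
  rewrite /B /ladderB.
  set I := Rintegral _ _ _; have -> : I = moment_functional f (P n.+1 * P n).
    by apply: eq_Rintegral => x _; rewrite hornerM /f /w; ring.
  congr (_ * (_ + _)).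
  by rewrite mulr_sumr; apply: eq_bigr => k _; rewrite /rhat /=; ring.
have hn := h_neq0 n; have hn1 := h_neq0 n.+1.
move: ibp1 ibp0; rewrite !Jmul !sumE DR0 DR1 phiE (SC (P n)).
rewrite (mulrC (P n) (P n.+1)).
(* Both relations are compared after multiplication by the nonzero factor [h n * phi(z)], the form
   in which [low] and [rai] are stated. *)
have idx (x y : R) : h n * ((z - z ^+ 2) * x) = h n * ((z - z ^+ 2) * y) -> x = y.
  by move=> /(mulfI hn)/(mulfI phiz).
move: low rai; rewrite phiE -![L _]/(moment_functional w _) => low rai ibp1 ibp0.
set I11 := moment_functional f (P n.+1 * P n.+1) in ibp1.
set I10 := moment_functional f (P n.+1 * P n) in ibp1 ibp0 BE.
set I00 := moment_functional f (P n * P n) in ibp0.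
set L1 := moment_functional w _ in low; set L0 := moment_functional w _ in rai.
have L1E : L1 = - ((P n).[z] * I11 - (P n.+1).[z] * I10)
    - ((P n).[z] * S (P n.+1) (P n.+1) - (P n.+1).[z] * S (P n.+1) (P n)).
  by rewrite ibp1 -/L1; ring.
have L0E : L0 = - (z - z ^+ 2) * derive1 (potential wJS) z * (h n * (P n).[z])
    - ((P n).[z] * I10 - (P n.+1).[z] * I00)
    - ((P n).[z] * S (P n.+1) (P n) - (P n.+1).[z] * S (P n) (P n)).
  by rewrite ibp0 -/L0; ring.
split; apply: idx; rewrite /preceding BE !AE.
  rewrite low L1E /rec_beta -/I11 [n.+1.-1]/=; field.
  by rewrite hn hn1 phiz.
rewrite rai L0E -/I00; field.
by rewrite hn phiz.
Qed.
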